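(* Consider the energy sharing game $\mathcal{G}$ (defined in the context) and the following centralized problem in the variables $\Delta d=(\Delta d_k)_{k\in\mathcal{I}\cup\mathcal{J}}$ (with $q^c=(q^c_k)_{k\in\mathcal{I}\cup\mathcal{J}}$ determined by the equality constraints): $$\text{(C)}\qquad \min_{\Delta d}\ \sum_{k\in\mathcal{I}\cup\mathcal{J}} f_k(\Delta d_k)$$ $$\text{s.t.}\quad q_k^c=\begin{cases} d_k+\Delta d_k, & k\in\mathcal{I},\\ d_k+\Delta d_k-w_k-\Delta w_k, & k\in\mathcal{J},\end{cases}\quad:\ \eta_k$$ $$\Delta d_k\in\mathcal{D}_k\ \ \forall k\in\mathcal{I}\cup\mathcal{J},\qquad q^c\in\mathcal{Q},$$ where $\eta_k$ denotes the dual variable of the $k$-th equality constraint. (i) If (C) is feasible, then $\mathcal{G}$ has at least one generalized Nash equilibrium. (ii) A profile $(\Delta d^*,q^*,q^{c*},\delta^* )$ is a generalized Nash equilibrium of $\mathcal{G}$ if and only if $\Delta d^*$ is the unique optimal solution of (C), and there is an optimal value $\hat\eta$ of the dual variable $\eta$ such that $\delta_k^*=-\hat\eta_k/\tau$ for all $k\in\mathcal{I}\cup\mathcal{J}$, $$q_k^*=\begin{cases} d_k+\Delta d_k^*-\delta_k^*, & k\in\mathcal{I},\\ d_k+\Delta d_k^*-w_k-\Delta w_k-\delta_k^*, & k\in\mathcal{J},\end{cases}$$ and $q_k^{c*}=q_k^*+\delta_k^*$ for all $k\in\mathcal{I}\cup\mathcal{J}$.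
   Context: Users. $\mathcal{I}$ (consumers, $|\mathcal{I}|=I$) and $\mathcal{J}$ (prosumers, $|\mathcal{J}|=J$) are disjoint finite index sets; $\mathcal{L}$ is a finite set of lines. Given real data: contract demands $d_k$ and bounds $\underline{D}_k,\overline{D}_k$ for $k\in\mathcal{I}\cup\mathcal{J}$; forecast renewable outputs $w_k$ and output deviations $\Delta w_k$ for $k\in\mathcal{J}$; line flow distribution factors $\pi_{kl}$ and line limits $F_l$ for $k\in\mathcal{I}\cup\mathcal{J}$, $l\in\mathcal{L}$; a parameter $\tau>0$; disutility functions $f_k(x)=\alpha_k x^2+\beta_k x+\zeta_k$ with $\alpha_k>0$ (so $f_k$ is strictly convex). Sets. $\mathcal{D}_k=\{\Delta d_k\in\mathbb{R} : \underline{D}_k\le d_k+\Delta d_k\le\overline{D}_k\}$, and $\mathcal{Q}=\{q^c\in\mathbb{R}^{I+J} : \sum_{k\in\mathcal{I}\cup\mathcal{J}} q_k^c=0,\ -F_l\le\sum_{k\in\mathcal{I}\cup\mathcal{J}}\pi_{kl}q_k^c\le F_l\ \forall l\in\mathcal{L}\}$. The energy sharing game $\mathcal{G}$. The players are the $I+J$ users and one operator. - Given the operator's strategy $(q^c,\delta)$, each user $k$ chooses $(\Delta d_k,q_k)\in\mathbb{R}^2$ to minimize $f_k(\Delta d_k)+\frac{\tau}{2}(q_k^c-q_k)^2$ subject to $\Delta d_k\in\mathcal{D}_k$ and the power balance $q_k+\delta_k=d_k+\Delta d_k$ if $k\in\mathcal{I}$, respectively $w_k+\Delta w_k+q_k+\delta_k=d_k+\Delta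 d_k$ if $k\in\mathcal{J}$. (Here $q_k^c$ and $\delta_k$ are both treated as fixed by the user.) - Given the users' strategies $(\Delta d,q)$, the operator chooses $(q^c,\delta)\in\mathbb{R}^{I+J}\times\mathbb{R}^{I+J}$ to minimize $\sum_{k\in\mathcal{I}\cup\mathcal{J}}\delta_k^2$ subject to $\delta_k=q_k^c-q_k$ for all $k\in\mathcal{I}\cup\mathcal{J}$ and $q^c\in\mathcal{Q}$. Generalized Nash equilibrium (GNE): a profile $(\Delta d^*,q^*,q^{c*},\delta^* )$ such that, for every user $k$, $(\Delta d_k^*,q_k^* )$ is an optimal solution of user $k$'s problem given $(q_k^{c*},\delta_k^* )$, and $(q^{c*},\delta^* )$ is an optimal solution of the operator's problem given $(\Delta d^*,q^* )$. Dual variable convention: $\hat\eta\in\mathbb{R}^{I+J}$ is an optimal value of the dual variable if, together with an optimal $(\Delta\hat d,\hat q^c)$ of (C), it forms a saddle point of the Lagrangian $$\sum_{k\in\mathcal{I}\cup\mathcal{J}} f_k(\Delta d_k)+\sum_{k\in\mathcal{I}}\eta_k(d_k+\Delta d_k-q_k^c)+\sum_{k\in\mathcal{J}}\eta_k(d_k+\Delta d_k-w_k-\Delta w_k-q_k^c)$$ minimized over $(\Delta d,q^c)\in\prod_k\mathcal{D}_k\times\mathcal{Q}$ and maximized over $\eta\in\mathbb{R}^{I+J}$. *)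

(* Defs.v *)
From HB Require Import structures.
From mathcomp Require Import all_boot all_order all_algebra.
From mathcomp Require Import classical_sets reals.

Set Implicit Arguments.
Unset Strict Implicit.
Unset Printing Implicit Defensive.

Import Order.TTheory GRing.Theory Num.Theory.

Local Open Scope classical_set_scope.
Local Open Scope ring_scope.

Definition minimizer (R : realType) (T : Type) (A : set T) (f : T -> R)
    (x : T) : Prop :=
  A x /\ forall y, A y -> f x <= f y.

(* The dual variable is unconstrained. *)
Definition saddle_point (R : realType) (X Y : Type) (A : set X)
    (Lag : X -> Y -> R) (x : X) (y : Y) : Prop :=
  [/\ A x,
      forall x', A x' -> Lag x y <= Lag x' y
    & forall y', Lag x y' <= Lag x y].

(* Users form the disjoint union I + J: [inl i] is a consumer, [inr j] a
   prosumer.  Vectors of R^(I+J) are functions on this type.  No sign or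
   ordering assumption is built into the record. *)
Record sharing_game (R : realType) (I J L : finType) := SharingGame {
  demand : I + J -> R;
  demand_lo : I + J -> R;
  demand_hi : I + J -> R;
  renewable : J -> R;
  renewable_dev : J -> R;
  flow_factor : I + J -> L -> R;
  line_limit : L -> R;
  tau : R;
  alpha : I + J -> R;
  beta : I + J -> R;
  zeta : I + J -> R
}.

Definition disutility (R : realType) (I J L : finType)
    (G : sharing_game R I J L) (k : I + J) (x : R) : R :=
  alpha G k * x ^+ 2 + beta G k * x + zeta G k.

Definition adjustment_set (R : realType) (I J L : finType)
    (G : sharing_game R I J L) (k : I + J) : set R :=
  [set x | demand_lo G k <= demand G k + x <= demand_hi G k].

Definition network_set (R : realType) (I J L : finType)
    (G : sharing_game R I J L) : set (I + J -> R) :=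
  [set qc | \sum_k qc k = 0 /\
    forall l, - line_limit G l <= \sum_k flow_factor G k l * qc k
              <= line_limit G l].

Definition power_balance (R : realType) (I J L : finType)
    (G : sharing_game R I J L) (k : I + J) (x qk deltak : R) : Prop :=
  match k with
  | inl _ => qk + deltak = demand G k + x
  | inr j =>
      renewable G j + renewable_dev G j + qk + deltak = demand G k + x
  end.

Definition user_feasible (R : realType) (I J L : finType)
    (G : sharing_game R I J L) (k : I + J) (deltak : R) : set (R * R) :=
  [set s | adjustment_set G k s.1 /\ power_balance G k s.1 s.2 deltak].

Definition user_cost (R : realType) (I J L : finType)
    (G : sharing_game R I J L) (k : I + J) (qck : R) (s : R * R) : R :=
  disutility G k s.1 + tau G / 2 * (qck - s.2) ^+ 2.

Definition operator_feasible (R : realType) (I J L : finType)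
    (G : sharing_game R I J L) (q : I + J -> R) :
    set ((I + J -> R) * (I + J -> R)) :=
  [set s | (forall k, s.2 k = s.1 k - q k) /\ network_set G s.1].

Definition operator_cost (R : realType) (I J : finType)
    (s : (I + J -> R) * (I + J -> R)) : R :=
  \sum_k s.2 k ^+ 2.

Definition is_GNE (R : realType) (I J L : finType)
    (G : sharing_game R I J L) (dd q qc delta : I + J -> R) : Prop :=
  (forall k, minimizer (user_feasible G k (delta k)) (user_cost G k (qc k))
               (dd k, q k)) /\
  minimizer (operator_feasible G q) (@operator_cost R I J) (qc, delta).

Definition net_demand (R : realType) (I J L : finType)
    (G : sharing_game R I J L) (k : I + J) (x : R) : R :=
  match k with
  | inl _ => demand G k + x
  | inr j => demand G k + x - renewable G j - renewable_dev G j
  end.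

(* Pairs (dd, qc) in prod_k D_k x Q, the coupling equalities being left to
   the multipliers. *)
Definition primal_domain (R : realType) (I J L : finType)
    (G : sharing_game R I J L) : set ((I + J -> R) * (I + J -> R)) :=
  [set x | (forall k, adjustment_set G k (x.1 k)) /\ network_set G x.2].

Definition central_feasible (R : realType) (I J L : finType)
    (G : sharing_game R I J L) : set ((I + J -> R) * (I + J -> R)) :=
  [set x | (forall k, x.2 k = net_demand G k (x.1 k)) /\ primal_domain G x].

Definition central_cost (R : realType) (I J L : finType)
    (G : sharing_game R I J L) (x : (I + J -> R) * (I + J -> R)) : R :=
  \sum_k disutility G k (x.1 k).

Definition central_optimal (R : realType) (I J L : finType)
    (G : sharing_game R I J L) : set ((I + J -> R) * (I + J -> R)) :=
  minimizer (central_feasible G) (central_cost G).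

Definition central_solution (R : realType) (I J L : finType)
    (G : sharing_game R I J L) : set (I + J -> R) :=
  [set dd | exists qc, central_optimal G (dd, qc)].

Definition lagrangian (R : realType) (I J L : finType)
    (G : sharing_game R I J L) (x : (I + J -> R) * (I + J -> R))
    (eta : I + J -> R) : R :=
  \sum_k disutility G k (x.1 k)
  + \sum_(i : I) eta (inl i) *
      (demand G (inl i) + x.1 (inl i) - x.2 (inl i))
  + \sum_(j : J) eta (inr j) *
      (demand G (inr j) + x.1 (inr j) - renewable G j - renewable_dev G j
       - x.2 (inr j)).

Definition dual_optimal (R : realType) (I J L : finType)
    (G : sharing_game R I J L) (eta : I + J -> R) : Prop :=
  exists x, central_optimal G x /\
    saddle_point (primal_domain G) (lagrangian G) x eta.

(* Main.v *)
Require Import Defs.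
From mathcomp Require Import all_boot all_order all_algebra.
From mathcomp Require Import boolp classical_sets reals.
From mathcomp Require Import ring lra.
From mathcomp Require Import topology normedtype derive.

Set Implicit Arguments.
Unset Strict Implicit.
Unset Printing Implicit Defensive.

Import Order.TTheory GRing.Theory Num.Theory.
Import numFieldNormedType.Exports ArrowAsProduct.

Local Open Scope classical_set_scope.
Local Open Scope ring_scope.

(** A profile is an equilibrium exactly when it solves a system of variational
    inequalities, and the saddle points of the Lagrangian solve the same system
    under eta = - tau * delta ([equilibrium_system]).

    User k pays f_k(x) + (tau/2) (q^c_k - q_k)^2 with q_k tied to x by the power
    balance, so the slope of the cost at the optimum is
    f_k'(x) - tau (q^c_k - q_k); at an equilibrium the operator makes
    q^c_k - q_k equal to delta_k, and the slope is f_k'(x) + eta_k.  The operator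
    projects q onto the network set, so delta is normal to that set at q^c, and
    so is - eta.  Finally q_k + delta_k = q^c_k turns the power balance into the
    coupling equality of the centralized problem ([GNE_iff_system]).  On the
    other side, minimizing the Lagrangian over the primal domain splits into the
    same inequality for each user and the same normality condition, while
    maximizing it over free multipliers forces the coupling equalities
    ([saddle_iff_system]).

    A solution of the system is optimal for the centralized problem with a
    quadratic margin, because all alpha_k are positive ([system_gap]); hence the
    optimal demand is unique.

    For the converse the centralized problem must have an optimum, which follows
    from compactness of the boxes D_k ([central_optimal_exists]), and this
    optimum must have a multiplier, with no interior point of the feasible set at
    hand.  Here the polyhedral form of the constraints is essential: Farkas'
    lemma writes minus the gradient as a combination of the constraint rows
    ([slab_multipliers]), and eta is the part of that combination which comes
    from the network rows ([central_optimal_system]). *)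

(** * Polyhedra and Farkas multipliers *)

Definition dot (R : nzRingType) (K : finType) (u v : K -> R) : R :=
  \sum_k u k * v k.

(** Polyhedra are described by two-sided constraints, so that an equation is the
    case lo = hi and a multiplier of either sign goes with each row. *)
Definition slabs (R : realFieldType) (K T : finType) (h : T -> K -> R)
    (lo hi : T -> R) : set (K -> R) :=
  [set x | forall t, lo t <= dot (h t) x <= hi t].

Lemma dotDZl (R : comNzRingType) (K : finType) (a : R) (u v w : K -> R) :
  dot (fun k => u k + a * v k) w = dot u w + a * dot v w.
Proof. by rewrite /dot mulr_sumr -big_split; apply: eq_bigr => k _ /=; ring. Qed.

Lemma dotDZr (R : comNzRingType) (K : finType) (a : R) (u v w : K -> R) :
  dot w (fun k => u k + a * v k) = dot w u + a * dot w v.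
Proof. by rewrite /dot mulr_sumr -big_split; apply: eq_bigr => k _ /=; ring. Qed.

Lemma dotB (R : comNzRingType) (K : finType) (u v w : K -> R) :
  dot w (fun k => u k - v k) = dot w u - dot w v.
Proof. by rewrite /dot -sumrB; apply: eq_bigr => k _ /=; ring. Qed.

Lemma slabs_seg (R : realFieldType) (K T : finType) (h : T -> K -> R)
    (lo hi : T -> R) (x y : K -> R) (t : R) :
  slabs h lo hi x -> slabs h lo hi y -> 0 <= t <= 1 ->
  slabs h lo hi (fun k => x k + t * (y k - x k)).
Proof.
move=> Px Py /andP[? ?] i; rewrite dotDZr dotB.
by have /andP[? ?] := Px i; have /andP[? ?] := Py i; nra.
Qed.

Lemma dot_suml (R : comNzRingType) (K T : finType) (m : T -> R) (h : T -> K -> R)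
    (x : K -> R) :
  dot (fun k => \sum_t m t * h t k) x = \sum_t m t * dot (h t) x.
Proof.
rewrite /dot; under eq_bigr do rewrite mulr_suml.
rewrite exchange_big /=; apply: eq_bigr => t _; rewrite mulr_sumr.
by apply: eq_bigr => k _; rewrite mulrA.
Qed.

Lemma dot_indicator (R : nzRingType) (K : finType) (k : K) (x : K -> R) :
  dot (fun i => (i == k)%:R) x = x k.
Proof.
rewrite /dot (bigD1 k) //= eqxx mul1r big1 ?addr0 // => i /negbTE ->.
by rewrite mul0r.
Qed.

(** Induction on the number of rows, after Bartl.  If the first row is needed,
    there is a direction [y0] on which the other rows are nonpositive but [c] is
    positive; the first row is then positive on [y0].  Projecting along [y0] onto
    the kernel of the first row preserves the hypothesis for the remaining rows,
    and the multiplier of the first row is recovered by evaluating at [y0]. *)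
Lemma farkas_ord (R : realFieldType) (K : finType) (m : nat)
    (a : 'I_m -> K -> R) (c : K -> R) :
  (forall y, (forall i, dot (a i) y <= 0) -> dot c y <= 0) ->
  exists lam : 'I_m -> R,
    (forall i, 0 <= lam i) /\ forall k, c k = \sum_i lam i * a i k.
Proof.
elim: m => [|m IH] in a c *.
  move=> H; exists (fun=> 0); split=> // k; rewrite big_ord0.
  have /H : forall i : 'I_0, dot (a i) c <= 0 by case.
  have : forall i, true -> 0 <= c i * c i by move=> i _; rewrite -expr2 sqr_ge0.
  move=> c2 Hc; apply/eqP.
  have /eqP : dot c c == 0 by rewrite eq_le Hc sumr_ge0.
  by move/(psumr_eq0P c2)/(_ k isT)/eqP; rewrite mulf_eq0 orbb.
move=> H; pose a1 i := a (lift ord0 i).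
have [Htail|] := pselect (forall y, (forall i, dot (a1 i) y <= 0) -> dot c y <= 0).
  have [lam [lam0 lamE]] := IH a1 c Htail.
  exists (fun i => if unlift ord0 i is Some j then lam j else 0); split.
    by move=> i; case: unliftP.
  move=> k; rewrite big_ord_recl unlift_none mul0r add0r lamE.
  by apply: eq_bigr => i _; rewrite liftK.
move=> /existsNP[y0 /not_implyP[ay0 /negP]]; rewrite -ltNge => cy0.
have s0 : 0 < dot (a ord0) y0.
  rewrite ltNge; apply/negP => a0y0; move: cy0; rewrite ltNge => /negP; apply.
  apply: H => i; case: (unliftP ord0 i) => [j|] -> //; exact: ay0.
set s := dot (a ord0) y0 in s0.
(* [P] is the adjoint of the projection along [y0]. *)
pose P (u : K -> R) k := u k + (- (dot u y0 / s)) * a ord0 k.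
have PE u y : dot (P u) y = dot u (fun k => y k + (- (dot (a ord0) y / s)) * y0 k).
  by rewrite dotDZl dotDZr; field; rewrite gt_eqF.
have [y Py|lam [lam0 lamE]] := IH (fun i => P (a1 i)) (P c).
  rewrite PE; apply: H => i; case: (unliftP ord0 i) => [j|] ->.
    by rewrite -PE; exact: Py.
  by rewrite dotDZr -/s mulNr divfK ?subrr // gt_eqF.
pose lam_0 := (dot c y0 - \sum_i lam i * dot (a1 i) y0) / s.
exists (fun i => if unlift ord0 i is Some j then lam j else lam_0); split.
  move=> i; case: unliftP => // _; rewrite divr_ge0 ?(ltW s0) // subr_ge0.
  rewrite (le_trans _ (ltW cy0)) // sumr_le0 // => j _.
  by rewrite mulr_ge0_le0.
move=> k; rewrite big_ord_recl unlift_none.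
under eq_bigr do rewrite liftK.
have -> : c k = \sum_i lam i * P (a1 i) k + dot c y0 / s * a ord0 k.
  by rewrite -lamE /P; ring.
have -> : \sum_i lam i * P (a1 i) k =
    \sum_i lam i * a1 i k - (\sum_i lam i * dot (a1 i) y0) / s * a ord0 k.
  by rewrite !mulr_suml -sumrB; apply: eq_bigr => i _; rewrite /P; ring.
by rewrite /lam_0 /a1; ring.
Qed.

Lemma farkas (R : realFieldType) (K T : finType)
    (a : T -> K -> R) (c : K -> R) :
  (forall y, (forall t, dot (a t) y <= 0) -> dot c y <= 0) ->
  exists lam : T -> R,
    (forall t, 0 <= lam t) /\ forall k, c k = \sum_t lam t * a t k.
Proof.
move=> H; have [y Hy|lam [lam0 lamE]] := @farkas_ord R K #|T| (a \o enum_val) c.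
  by apply: H => t; rewrite -[t]enum_rankK; exact: Hy.
exists (lam \o enum_rank); split=> [t|k]; first exact: lam0.
rewrite lamE (reindex enum_rank) /=; last exact/onW_bij/enum_rank_bij.
by apply: eq_bigr => t _; rewrite enum_rankK.
Qed.

(** The normal cone of a polyhedron at [x] is spanned by the active rows: a
    direction which no active constraint forbids stays feasible for a small step,
    so Farkas' lemma applies to the active rows.  Complementary slackness is
    expressed by saying that each multiplier is normal to its interval. *)
Lemma slab_multipliers (R : realFieldType) (K T : finType)
    (h : T -> K -> R) (lo hi : T -> R) (c x : K -> R) :
  slabs h lo hi x ->
  (forall y, slabs h lo hi y -> dot c (fun k => y k - x k) <= 0) ->
  exists m : T -> R,
    (forall k, c k = \sum_t m t * h t k) /\
    forall t z, lo t <= z <= hi t -> m t * (z - dot (h t) x) <= 0.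
Proof.
move=> Px xmax.
(* Row [t] is used with sign + when its upper bound is active and - when its
   lower bound is; inactive constraints become zero rows. *)
pose act (tb : T * bool) : R :=
  if tb.2 then (dot (h tb.1) x == hi tb.1)%:R
  else - (dot (h tb.1) x == lo tb.1)%:R.
pose a (tb : T * bool) k := act tb * h tb.1 k.
have aE tb y : dot (a tb) y = act tb * dot (h tb.1) y.
  by rewrite /dot mulr_sumr; apply: eq_bigr => k _; rewrite mulrA.
have [y ay|lam [lam0 lamE]] := @farkas R K _ a c.
  (* [step t] is the distance at which the constraint [t] becomes active. *)
  pose step t := if 0 < dot (h t) y then (hi t - dot (h t) x) / dot (h t) y
    else if dot (h t) y < 0 then (lo t - dot (h t) x) / dot (h t) y else 1.
  have step0 t : 0 < step t.
    have [lox hix] := andP (Px t).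
    have := ay (t, true); have := ay (t, false); rewrite !aE /act /= /step.
    case: (ltgtP (dot (h t) y) 0) => // hy.
      move=> + _; rewrite nmulr_lgt0 ?invr_lt0 // subr_lt0 lt_neqAle lox andbT.
      by apply: contraTneq => ->; rewrite eqxx mulN1r -ltNge oppr_gt0.
    move=> _ up; rewrite divr_gt0 // subr_gt0 lt_neqAle hix andbT.
    by move: up; apply: contraTneq => ->; rewrite eqxx mul1r -ltNge.
  pose s : R := \big[Num.min/1]_t step t.
  have s0 : 0 < s by apply: lt_bigmin => [|t _]; [exact: ltr01|exact: step0].
  have /xmax : slabs h lo hi (fun k => x k + s * y k).
    move=> t; rewrite dotDZr; have [lox hix] := andP (Px t).
    have : s <= step t by exact: bigmin_le_cond.
    rewrite /step; case: (ltgtP (dot (h t) y) 0) => hy.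
    - by rewrite ler_ndivlMr // => ?; have := nmulr_rlt0 s hy; nra.
    - by rewrite ler_pdivlMr // => ?; nra.
    - by rewrite hy mulr0 addr0 lox.
  rewrite [X in X <= 0](_ : _ = s * dot c y) ?pmulr_rle0 //.
  by rewrite /dot mulr_sumr; apply: eq_bigr => k _; ring.
exists (fun t => lam (t, true) * act (t, true) + lam (t, false) * act (t, false)).
split=> [k|t z /andP[loz zhi]].
  rewrite lamE (eq_bigr (fun p => lam (p.1, p.2) * a (p.1, p.2) k)) => [|[] //].
  rewrite -(pair_bigA _ (fun t b => lam (t, b) * a (t, b) k)) /=.
  by apply: eq_bigr => t _; rewrite big_bool /a /=; ring.
have act_le0 b : act (t, b) * (z - dot (h t) x) <= 0.
  by rewrite /act; case: b => /=; case: eqP => [->|_] /=; lra.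
by rewrite mulrDl -!mulrA -[leRHS]addr0 lerD // mulr_ge0_le0.
Qed.

(** * Quadratic minimization *)

(** Optimality of [x] for a function which is quadratic along the segments from
    [x]: [G y] is the slope at [x] towards [y] and [S y] the curvature.  Segments
    are abstract because the feasible points are pairs of numbers, functions or
    pairs of functions. *)
Lemma minimizer_slope (R : realType) (T : Type) (A : set T) (f : T -> R)
    (x : T) (seg : T -> R -> T) (G S : T -> R) :
  (forall y t, A y -> 0 < t <= 1 -> A (seg y t)) ->
  (forall y, 0 <= S y) ->
  (forall y, A y -> f y = f x + G y + S y) ->
  (forall y t, A y -> f (seg y t) = f x + t * G y + t ^+ 2 * S y) ->
  minimizer A f x <-> (A x /\ forall y, A y -> 0 <= G y).
Proof.
move=> Aseg S0 fE fsegE; split=> [[Ax xmin]|[Ax G0]]; split=> // y Ay; last first.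
  by rewrite (fE y) // -addrA lerDl addr_ge0 // G0.
rewrite leNgt; apply/negP => Gy.
(* With this step t, t * S < - G, so the curvature cannot offset the descent. *)
have GS0 : 0 < S y - G y by rewrite subr_gt0 (lt_le_trans Gy).
pose t := - G y / (S y - G y).
have t01 : 0 < t <= 1.
  rewrite divr_gt0 ?oppr_gt0 //= ler_pdivrMr // mul1r.
  by rewrite lerDr.
have := xmin _ (Aseg y t Ay t01); rewrite fsegE // -addrA lerDl.
have /andP[t0 _] := t01.
have -> : t * G y + t ^+ 2 * S y = t * (t * (G y)).
  by rewrite /t; field; rewrite gt_eqF.
by apply/negP; rewrite -ltNge !pmulr_rlt0.
Qed.

(** * Continuity of finite sums and closedness of polyhedra *)

Lemma continuous_sum (R : realType) (K : finType) (T : topologicalType)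
    (F : K -> T -> R) :
  (forall k, continuous (F k)) -> continuous (fun x => \sum_k F k x).
Proof. by move=> cF; apply: continuous_big => //; exact: add_continuous. Qed.

Lemma continuous_coord (R : realType) (K : finType) (k : K) :
  continuous (fun x : K -> R => x k).
Proof. exact: (@proj_continuous K (fun=> R) k). Qed.

Lemma continuous_dot (R : realType) (K : finType) (u : K -> R) :
  continuous (dot u).
Proof.
apply: continuous_sum => k x.
exact: (@cvgMl_tmp R _ _ _ (fun y : K -> R => y k) (u k) _
  (@continuous_coord R K k x)).
Qed.

Lemma closed_slabs (R : realType) (K T : finType) (h : T -> K -> R)
    (lo hi : T -> R) :
  closed (slabs h lo hi).
Proof.
rewrite (_ : slabs h lo hi =
  \bigcap_(t in [set: T]) (dot (h t) @^-1` [set` `[lo t, hi t]])).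
  apply: closed_bigI => t _.
  have /continuous_closedP := @continuous_dot R K (h t).
  by apply; exact: interval_closed.
apply/seteqP; split=> x /= Px t; first by move=> _; rewrite /= in_itv; exact: Px.
by have := Px t Logic.I; rewrite /= in_itv.
Qed.

(** * The sharing game *)

Section Game.
Variables (R : realType) (I J L : finType) (G : sharing_game R I J L).
Hypotheses (htau : 0 < tau G) (halpha : forall k : I + J, 0 < alpha G k).

Definition marginal_disutility (k : I + J) (x : R) : R :=
  2 * alpha G k * x + beta G k.

(** The optimality conditions shared by the game and by the Lagrangian: [eta]
    balances the marginal disutilities over the boxes and is normal to the
    network set. *)
Definition equilibrium_system (x q eta : I + J -> R) : Prop :=
  [/\ central_feasible G (x, q),
      forall k z, adjustment_set G k z ->
        0 <= (marginal_disutility k (x k) + eta k) * (z - x k)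
    & forall q', network_set G q' -> dot eta (fun k => q' k - q k) <= 0].

Lemma disutility_expansion k x y :
  disutility G k y = disutility G k x + marginal_disutility k x * (y - x)
    + alpha G k * (y - x) ^+ 2.
Proof. by rewrite /disutility /marginal_disutility; ring. Qed.

Lemma net_demandE k x : net_demand G k x = net_demand G k 0 + x.
Proof. by case: k => k /=; ring. Qed.

Lemma power_balanceE k x q d :
  power_balance G k x q d <-> q + d = net_demand G k x.
Proof. by case: k => k //=; split=> H; lra. Qed.

Lemma adjustment_set_seg k x y t :
  adjustment_set G k x -> adjustment_set G k y -> 0 <= t <= 1 ->
  adjustment_set G k (x + t * (y - x)).
Proof. by rewrite /adjustment_set /= => /andP[? ?] /andP[? ?] /andP[? ?]; nra. Qed.

(** The row [None] encodes the balance condition of the network set, as a slab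
    of width zero. *)
Definition network_row (t : option L) (k : I + J) : R :=
  if t is Some l then flow_factor G k l else 1.

Definition network_limit (t : option L) : R :=
  if t is Some l then line_limit G l else 0.

Lemma network_setE q :
  network_set G q <->
  slabs network_row (fun t => - network_limit t) network_limit q.
Proof.
have E : dot (network_row None) q = \sum_k q k.
  by apply: eq_bigr => k _; rewrite mul1r.
split=> [[q0 qF] [l|] |H]; first exact: qF.
  by rewrite E q0 /= oppr0 lexx.
split=> [|l]; last exact: (H (Some l)).
by apply/eqP; have := H None; rewrite E /= oppr0 -eq_le eq_sym.
Qed.

Lemma network_set_seg x y t :
  network_set G x -> network_set G y -> 0 <= t <= 1 ->
  network_set G (fun k => x k + t * (y k - x k)).
Proof. rewrite !network_setE; exact: slabs_seg. Qed.

(** The user moves q_k together with the demand, so the penalty contributes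
    - tau * (q - qk) to the slope. *)
Lemma user_minimizerE k q d x qk :
  d = q - qk ->
  minimizer (user_feasible G k d) (user_cost G k q) (x, qk) <->
  [/\ adjustment_set G k x, qk + d = net_demand G k x &
      forall z, adjustment_set G k z ->
        0 <= (marginal_disutility k x - tau G * d) * (z - x)].
Proof.
move=> dE.
have [xf|nxf] := pselect (user_feasible G k d (x, qk)); last first.
  by split=> [[]|[Dx /power_balanceE bal _]] //; case: nxf.
rewrite (@minimizer_slope _ _ _ _ _
  (fun s t => (x + t * (s.1 - x), qk + t * (s.2 - qk)))
  (fun s => (marginal_disutility k x - tau G * d) * (s.1 - x))
  (fun s => alpha G k * (s.1 - x) ^+ 2 + tau G / 2 * (s.2 - qk) ^+ 2)).
- have [Dx /power_balanceE bal] := xf; split=> [[_ H]|[_ _ H]]; split=> //.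
    move=> z Dz; apply: (H (z, net_demand G k z - d)); split=> //=.
    by apply/power_balanceE; rewrite subrK.
  by move=> [z qz] [/H].
- move=> [z qz] t [/= Dz /power_balanceE bz] /andP[t0 t1].
  have [/= Dx /power_balanceE bx] := xf; split=> /=.
    by apply: adjustment_set_seg; rewrite // (ltW t0).
  apply/power_balanceE; move: bz bx; rewrite !(net_demandE _ (_ + _)) => bz bx.
  by rewrite (net_demandE _ z) in bz; rewrite (net_demandE _ x) in bx; nra.
- move=> s; have := halpha k; have := htau; have := sqr_ge0 (s.1 - x).
  by have := sqr_ge0 (s.2 - qk); nra.
- move=> [z qz] [/= Dz /power_balanceE bz].
  have [/= Dx /power_balanceE bx] := xf.
  rewrite (net_demandE _ z) in bz; rewrite (net_demandE _ x) in bx.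
  have -> : qz = qk + (z - x) by lra.
  by rewrite /user_cost /= (disutility_expansion k x z) dE; field.
- move=> [z qz] t [/= Dz /power_balanceE bz].
  have [/= Dx /power_balanceE bx] := xf.
  rewrite (net_demandE _ z) in bz; rewrite (net_demandE _ x) in bx.
  have -> : qz = qk + (z - x) by lra.
  by rewrite /user_cost /= (disutility_expansion k x (_ + _)) dE; field.
Qed.

(** The operator projects [q] onto the network set; this is the obtuse-angle
    characterization of the projection. *)
Lemma operator_minimizerE q qc d :
  minimizer (operator_feasible G q) (@operator_cost R I J) (qc, d) <->
  [/\ forall k, d k = qc k - q k, network_set G qc &
      forall q', network_set G q' -> 0 <= dot d (fun k => q' k - qc k)].
Proof.
have [xf|nxf] := pselect (operator_feasible G q (qc, d)); last first.
  by split=> [[]|[dE Q _]] //; case: nxf.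
have [/= dE Q] := xf.
rewrite (@minimizer_slope _ _ _ _ _
  (fun s t => (fun k => qc k + t * (s.1 k - qc k),
               fun k => d k + t * (s.2 k - d k)))
  (fun s => 2 * dot d (fun k => s.1 k - qc k))
  (fun s => \sum_k (s.2 k - d k) ^+ 2)).
- split=> [[_ H]|[_ _ H]]; split=> //.
    move=> q' Qq'; have := H (q', fun k => q' k - q k) (conj (fun k => erefl) Qq').
    by rewrite pmulr_rge0.
  by move=> s [_ /H]; rewrite pmulr_rge0.
- move=> s t [/= sE Qs] /andP[t0 t1]; split=> /= [k|].
    by rewrite sE dE; ring.
  by apply: network_set_seg; rewrite // (ltW t0).
- by move=> s; apply: sumr_ge0 => k _; rewrite sqr_ge0.
- move=> s [sE _]; rewrite /operator_cost /dot mulr_sumr -!big_split.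
  by apply: eq_bigr => k _ /=; rewrite sE dE; ring.
- move=> s t [sE _]; rewrite /operator_cost /dot !mulr_sumr -!big_split.
  by apply: eq_bigr => k _ /=; rewrite sE dE; ring.
Qed.

Lemma GNE_iff_system dd q qc delta :
  is_GNE G dd q qc delta <->
  equilibrium_system dd qc (fun k => - (tau G * delta k)) /\
  (forall k, qc k = q k + delta k).
Proof.
rewrite /is_GNE operator_minimizerE.
have dotE y : dot (fun k => - (tau G * delta k)) y = - (tau G * dot delta y).
  by rewrite /dot mulr_sumr -sumrN; apply: eq_bigr => k _; ring.
split=> [[U [dE Q O]]|[[[/= qcE [/= D Q]] U O] qcqd]].
  have {}U k := (user_minimizerE k (dd k) (dE k)).1 (U k).
  split; last by move=> k; rewrite dE; ring.
  split=> [|k z Dz|q' Qq'].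
  - split=> /= [k|]; last by split=> //= k; have [] := U k.
    by have [_ <- _] := U k; rewrite dE; ring.
  - by have [_ _] := U k; exact.
  - by rewrite dotE oppr_le0 pmulr_rge0 // O.
have dE k : delta k = qc k - q k by rewrite qcqd; ring.
split=> [k|].
  apply/user_minimizerE => //; split=> // [|z Dz]; last exact: U.
  by rewrite -qcE.
by split=> // q' /O; rewrite dotE oppr_le0 pmulr_rge0.
Qed.

Lemma lagrangianE x q eta :
  lagrangian G (x, q) eta =
  \sum_k disutility G k (x k) + dot eta (fun k => net_demand G k (x k) - q k).
Proof. by rewrite /lagrangian -addrA; congr (_ + _); rewrite /dot big_sumType. Qed.

(** Raising the multiplier by the residual of the coupling equalities increases
    the Lagrangian by the squared norm of the residual, so the residual vanishes.
    The two inequalities follow from changing one demand, or only the network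
    flows, at a time. *)
Lemma saddle_iff_system x q eta :
  saddle_point (primal_domain G) (lagrangian G) (x, q) eta <->
  equilibrium_system x q eta.
Proof.
have [xf|nxf] := pselect (primal_domain G (x, q)); last first.
  by split=> [[]|[[]]] //.
have [/= D Q] := xf.
have slope := @minimizer_slope _ _ (primal_domain G) (lagrangian G ^~ eta) (x, q)
  (fun s t => (fun k => x k + t * (s.1 k - x k), fun k => q k + t * (s.2 k - q k)))
  (fun s => dot (fun k => marginal_disutility k (x k) + eta k) (fun k => s.1 k - x k)
            - dot eta (fun k => s.2 k - q k))
  (fun s => \sum_k alpha G k * (s.1 k - x k) ^+ 2).
have {}slope : minimizer (primal_domain G) (lagrangian G ^~ eta) (x, q) <->
    (primal_domain G (x, q) /\ forall s, primal_domain G s ->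
      0 <= dot (fun k => marginal_disutility k (x k) + eta k) (fun k => s.1 k - x k)
            - dot eta (fun k => s.2 k - q k)).
  apply: slope.
  - move=> s t [Ds Qs] /andP[t0 t1]; split=> /= [k|].
      by apply: adjustment_set_seg; rewrite // (ltW t0).
    by apply: network_set_seg; rewrite // (ltW t0).
  - by move=> s; apply: sumr_ge0 => k _; rewrite mulr_ge0 ?sqr_ge0 // ltW.
  - move=> [y p] _; rewrite !lagrangianE /dot /= -sumrB -!big_split.
    apply: eq_bigr => k _ /=.
    rewrite (disutility_expansion k (x k) (y k)) (net_demandE _ (y k)).
    by rewrite (net_demandE _ (x k)); ring.
  - move=> [y p] t _; rewrite !lagrangianE /dot /= -sumrB !mulr_sumr -!big_split.
    apply: eq_bigr => k _ /=.
    rewrite (disutility_expansion k (x k) (_ + _)) (net_demandE _ (_ + _)).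
    by rewrite (net_demandE _ (x k)); ring.
split=> [[_ xmin etamax]|[[/= qE _] U O]].
  have [_ {}slope] := slope.1 (conj xf xmin).
  split=> [|k z Dz|q' Qq'].
  - split=> //= k.
    pose r k := net_demand G k (x k) - q k.
    have := etamax (fun k => eta k + 1 * r k).
    rewrite !lagrangianE lerD2l dotDZl gerDl mul1r => rr.
    have r0 i : true -> 0 <= r i * r i by move=> _; rewrite -expr2 sqr_ge0.
    have /eqP : dot r r == 0 by rewrite eq_le rr sumr_ge0.
    move/(psumr_eq0P r0)/(_ k isT)/eqP; rewrite mulf_eq0 orbb subr_eq0.
    by move=> /eqP.
  - have /slope : primal_domain G (fun i => if i == k then z else x i, q).
      by split=> //= i; case: eqP => [->|_].
    rewrite /dot /= (bigD1 k) //= eqxx big1 ?addr0; last first.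
      by move=> i /negbTE ->; rewrite subrr mulr0.
    by rewrite [X in _ - X]big1 ?subr0 // => i _; rewrite subrr mulr0.
  - have /slope : primal_domain G (x, q') by [].
    rewrite {1}/dot /= big1 ?sub0r ?oppr_ge0 // => i _.
    by rewrite subrr mulr0.
have /slope[_ xmin] : primal_domain G (x, q) /\ forall s, primal_domain G s ->
      0 <= dot (fun k => marginal_disutility k (x k) + eta k) (fun k => s.1 k - x k)
            - dot eta (fun k => s.2 k - q k).
  split=> // s [Ds /O Qs]; rewrite subr_ge0 (le_trans Qs) //.
  by apply: sumr_ge0 => k _; exact: U.
split=> // eta'; rewrite !lagrangianE lerD2l /dot !big1 // => k _;
  by rewrite -qE subrr mulr0.
Qed.

(** Sum the users' inequalities and the network inequality: the multiplier terms
    cancel by the coupling equalities and the curvature remains. *)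
Lemma system_gap x q eta y p :
  equilibrium_system x q eta -> central_feasible G (y, p) ->
  central_cost G (x, q) + \sum_k alpha G k * (y k - x k) ^+ 2
    <= central_cost G (y, p).
Proof.
move=> [[/= qE _] U O] [/= pE [/= Dy Qp]].
have {}O := O p Qp.
have : 0 <= \sum_k (marginal_disutility k (x k) + eta k) * (y k - x k).
  by apply: sumr_ge0 => k _; exact: U.
move=> /(le_trans O); rewrite -subr_ge0 => H.
rewrite -subr_ge0 (le_trans H) // le_eqVlt; apply/orP; left; apply/eqP.
rewrite /central_cost /dot -!(sumrB, big_split) /=; apply: eq_bigr => k _.
rewrite pE qE (net_demandE _ (y k)) (net_demandE _ (x k)).
by rewrite (disutility_expansion k (x k) (y k)); ring.
Qed.

Lemma system_central_optimal x q eta :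
  equilibrium_system x q eta -> central_optimal G (x, q).
Proof.
move=> sys; split=> [|[y p] yf]; first by case: sys.
apply: le_trans (system_gap sys yf); rewrite lerDl.
by apply: sumr_ge0 => k _; rewrite mulr_ge0 ?sqr_ge0 // ltW.
Qed.

Lemma system_unique x q eta :
  equilibrium_system x q eta -> unique (central_solution G) x.
Proof.
move=> sys; split; first by exists q; exact: system_central_optimal sys.
move=> y [p [yf ymin]].
have xf : central_feasible G (x, q) by case: sys.
have := le_trans (system_gap sys yf) (ymin _ xf); rewrite gerDl => gap.
have a0 k : true -> 0 <= alpha G k * (y k - x k) ^+ 2.
  by move=> _; rewrite mulr_ge0 ?sqr_ge0 // ltW.
have /eqP gap0 : \sum_k alpha G k * (y k - x k) ^+ 2 == 0.
  by rewrite eq_le gap sumr_ge0.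
apply/funext => k; move: gap0 => /(psumr_eq0P a0)/(_ k isT)/eqP.
by rewrite mulf_eq0 gt_eqF //= sqrf_eq0 subr_eq0 eq_sym => /eqP.
Qed.

(** The centralized problem in the demand adjustments alone: the coupling
    equalities shift the network limits by the flows of the zero adjustment. *)
Definition central_row (t : (I + J) + option L) : I + J -> R :=
  match t with
  | inl k => fun i => (i == k)%:R
  | inr t => network_row t
  end.

Definition central_lo (t : (I + J) + option L) : R :=
  match t with
  | inl k => demand_lo G k - demand G k
  | inr t => - network_limit t - dot (network_row t) (fun k => net_demand G k 0)
  end.

Definition central_hi (t : (I + J) + option L) : R :=
  match t with
  | inl k => demand_hi G k - demand G k
  | inr t => network_limit t - dot (network_row t) (fun k => net_demand G k 0)
  end.

Lemma central_feasibleE x q :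
  central_feasible G (x, q) <->
  (slabs central_row central_lo central_hi x /\
   forall k, q k = net_demand G k (x k)).
Proof.
have E t : (forall k, q k = net_demand G k (x k)) ->
    dot (network_row t) q = dot (network_row t) (fun k => net_demand G k 0)
                            + dot (network_row t) x.
  move=> qE; rewrite -[X in _ + X]mul1r -dotDZr; apply: eq_bigr => k _.
  by rewrite qE net_demandE mul1r.
split=> [[/= qE [/= D /network_setE Q]]|[P qE]].
  split=> // -[k|t] /=.
    by rewrite dot_indicator; have := D k; rewrite /adjustment_set /=; lra.
  by have := Q t; rewrite E //; lra.
split=> //; split=> /= [k|].
  have := P (inl k); rewrite /= dot_indicator /adjustment_set /=; lra.
by apply/network_setE => t; have := P (inr t); rewrite E //=; lra.
Qed.

(** The rows of the boxes only affect their own coordinate, where their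
    multipliers give the users' inequalities; the rows of the network add up to
    [eta], which is normal to the network set by complementary slackness. *)
Lemma central_optimal_system x q :
  central_optimal G (x, q) -> exists eta, equilibrium_system x q eta.
Proof.
move=> [xf xmin].
have [Px qE] := (central_feasibleE x q).1 xf.
pose g k := marginal_disutility k (x k).
have opt y : slabs central_row central_lo central_hi y ->
    dot (fun k => - g k) (fun k => y k - x k) <= 0.
  have slope := (@minimizer_slope R _ (slabs central_row central_lo central_hi)
    (fun y => \sum_k disutility G k (y k)) x
    (fun y t k => x k + t * (y k - x k))
    (fun y => dot g (fun k => y k - x k))
    (fun y => \sum_k alpha G k * (y k - x k) ^+ 2) _ _ _ _).1.
  have [] := slope.
  - by move=> z t Pz /andP[t0 t1]; apply: slabs_seg; rewrite // (ltW t0).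
  - by move=> z; apply: sumr_ge0 => k _; rewrite mulr_ge0 ?sqr_ge0 // ltW.
  - move=> z _; rewrite /dot -!big_split; apply: eq_bigr => k _ /=.
    by rewrite (disutility_expansion k (x k) (z k)).
  - move=> z t _; rewrite /dot !mulr_sumr -!big_split; apply: eq_bigr => k _ /=.
    by rewrite (disutility_expansion k (x k) (_ + _)) /g; ring.
  - split=> // z Pz; apply: (xmin (z, fun k => net_demand G k (z k))).
    exact/central_feasibleE.
  - move=> _ H /H; rewrite -oppr_le0; congr (_ <= 0).
    by rewrite /dot -sumrN; apply: eq_bigr => k _; ring.
have [m [mE ms]] := slab_multipliers Px opt.
exists (fun k => \sum_t m (inr t) * network_row t k).
have {}mE k : g k + \sum_t m (inr t) * network_row t k = - m (inl k).
  have := mE k; rewrite big_sumType /=.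
  rewrite (bigD1 k) //= eqxx mulr1 big1 ?addr0 => [H|i]; first by lra.
  by rewrite eq_sym => /negbTE ->; rewrite mulr0.
split=> // [k z Dz|q' /network_setE Qq'].
  rewrite mE mulNr oppr_ge0.
  have := ms (inl k) z; rewrite /= dot_indicator; apply.
  by move: Dz; rewrite /adjustment_set /=; lra.
rewrite dot_suml sumr_le0 // => t _.
pose s := dot (network_row t) (fun k => net_demand G k 0).
have := ms (inr t) (dot (network_row t) q' - s).
have -> : dot (network_row t) q' - s - dot (central_row (inr t)) x =
          dot (network_row t) (fun k => q' k - q k).
  rewrite /= dotB (_ : dot (network_row t) q = s + 1 * dot (network_row t) x).
    by ring.
  by rewrite -dotDZr; apply: eq_bigr => k _; rewrite qE net_demandE mul1r.
by apply; have := Qq' t; rewrite /= -/s; lra.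
Qed.

Lemma continuous_disutility k : continuous (disutility G k).
Proof.
move=> x; apply: cvgD; last exact: cvg_cst.
by apply: cvgD; apply: cvgMl_tmp; [apply: cvgM; exact: cvg_id|exact: cvg_id].
Qed.

Lemma central_optimal_exists :
  (exists z, central_feasible G z) -> exists z, central_optimal G z.
Proof.
move=> [[x0 q0] /central_feasibleE[Px0 _]].
pose D k := [set z | adjustment_set G k z].
have cD : compact [set x : I + J -> R | forall k, D k (x k)].
  apply: tychonoff => k.
  rewrite (_ : D k = [set` `[demand_lo G k - demand G k, demand_hi G k - demand G k]]).
    exact: segment_compact.
  by apply/seteqP; split=> z /=; rewrite in_itv /D /adjustment_set /=; lra.
have cP : compact (slabs central_row central_lo central_hi).
  apply: (subclosed_compact _ cD) => [|x Px k]; first exact: closed_slabs.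
  have := Px (inl k); rewrite /D /adjustment_set /= dot_indicator; lra.
have [||x Px xmin] := compact_EVT_min (f := fun x => \sum_k disutility G k (x k)) _ cP.
- by exists x0.
- apply: continuous_subspaceT; apply: continuous_sum => k x.
  apply: (@continuous_comp _ _ _ (fun y : I + J -> R => y k) (disutility G k)).
    exact: continuous_coord.
  exact: continuous_disutility.
exists (x, fun k => net_demand G k (x k)); split.
  by apply/central_feasibleE; split=> //; exact: set_mem Px.
by move=> [y p] /central_feasibleE[Py _]; apply: xmin; exact: mem_set.
Qed.

End Game.

Theorem proposition1 (R : realType) (I J L : finType)
    (G : sharing_game R I J L)
    (htau : 0 < tau G) (halpha : forall k : I + J, 0 < alpha G k) :
  ((exists x, central_feasible G x) ->
   exists dd q qc delta : I + J -> R, is_GNE G dd q qc delta) /\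
  (forall dd q qc delta : I + J -> R,
     is_GNE G dd q qc delta <->
     (unique (central_solution G) dd /\
      exists eta : I + J -> R,
        [/\ dual_optimal G eta,
            forall k, delta k = - eta k / tau G,
            forall k, q k = net_demand G k (dd k) - delta k
          & forall k, qc k = q k + delta k])).
Proof.
split=> [/central_optimal_exists[[x q] /(central_optimal_system halpha)[eta sys]]|].
  exists x, (fun k => q k + eta k / tau G), q, (fun k => - eta k / tau G).
  apply/(GNE_iff_system htau halpha); split=> [|k]; last by ring.
  rewrite (_ : (fun k => _) = eta) //; apply/funext => k; field.
  by rewrite gt_eqF.
move=> dd q qc delta; rewrite (GNE_iff_system htau halpha).
split=> [[sys qcE]|[[_ dd_unique] [eta [[[x p] [xopt sad]] dE qE qcE]]]].
  split; first exact: system_unique sys.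
  exists (fun k => - (tau G * delta k)); split=> // [|k|k].
  - exists (dd, qc); split; first exact: system_central_optimal sys.
    exact/saddle_iff_system.
  - by field; rewrite gt_eqF.
  - have [[/= E _] _ _] := sys.
    by rewrite -E qcE addrK.
split=> //.
have /(saddle_iff_system halpha) sys := sad.
have ddx : dd = x by apply: dd_unique; exists p.
have -> : (fun k => - (tau G * delta k)) = eta.
  by apply/funext => k; rewrite dE; field; rewrite gt_eqF.
suff -> : qc = p by rewrite ddx.
have [[/= pE _] _ _] := sys.
by apply/funext => k; rewrite qcE qE subrK pE ddx.
Qed.
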